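(* If all groups have positive expected turnout, then the ordering of the magnitudes of the penalty pivots of the groups is opposite to the ordering of the expected turnouts of the groups: if $\lambda_i>0$ for all $i\in\{1,\dots,K\}$ and $\lambda_j>\lambda_k$, then $|QP_{A,k}|>|QP_{A,j}|$.
   Context: Voters are divided into $K\ge2$ groups. From the perspective of any given voter in a group, the numbers of votes for party $\mathcal A$ cast by all other voters in groups $1,\dots,K$ are independent Poisson random variables $A_1,\dots,A_K$ with means $\lambda_1,\dots,\lambda_K$, where $\lambda_i=n_ip_i$, $n_i$ is the expected size of group $i$ and $p_i$ the probability that a member of group $i$ votes for $\mathcal A$. Punishment rule: party $\mathcal A$ punishes group $k$ if and only if its number of votes for $\mathcal A$ is strictly less than that of every other group. The penalty pivot $QP_{A,k}$ is the probability that group $k$ is punished if a given member of $k$ votes for $\mathcal A$ (so that the vote counts are $A_k+1$ and $A_i$, $i\ne k$) minus the probability that it is punished if she abstains (so that the vote counts are $A_1,\dots,A_K$). Equivalently, with $f_\lambda(a)=\frac{\lambda^a}{a!}e^{-\lambda}$ and $F_\lambda(a)=\sum_{z=0}^a f_\lambda(z)$, $$QP_{A,k}=\sum_{a=0}^{\infty} f_{\lambda_k}(a)\left(\prod_{i\neq k}\big(1-F_{\lambda_i}(a+1)\big)-\prod_{i\ne k}\big(1-F_{\lambda_i}(a)\big)\right)\le 0.$$ *)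

(* Defs.v *)
From HB Require Import structures.
From mathcomp Require Import all_boot all_order all_algebra.
From mathcomp Require Import all_classical all_reals all_analysis.

Set Implicit Arguments.
Unset Strict Implicit.
Unset Printing Implicit Defensive.

Import Order.TTheory GRing.Theory Num.Theory.

Local Open Scope classical_set_scope.
Local Open Scope ring_scope.

Definition mutually_independent d d' (T : measurableType d)
    (T' : measurableType d') (R : realType) (P : probability T R)
    (I : finType) (X : I -> {RV P >-> T'}) : Prop :=
  forall (J : {set I}) (B : I -> set T'),
    (forall i, i \in J -> measurable (B i)) ->
    P (\bigcap_(i in [set` J]) (X i @^-1` B i))
      = (\prod_(i in J) P (X i @^-1` B i))%E.

(* The second argument of the library's [poisson_prob] is a dummy on which the
   measure does not depend. *)
Definition has_poisson_law d (T : measurableType d) (R : realType)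
    (P : probability T R) (X : {RV P >-> nat}) (rate : R) : Prop :=
  forall U : set nat, distribution P X U = poisson_prob rate 0 U.

Definition punished (K : nat) (v : 'I_K -> nat) (k : 'I_K) : Prop :=
  forall i, i != k -> (v k < v i)%N.

Definition add_vote (K : nat) (k : 'I_K) (v : 'I_K -> nat) : 'I_K -> nat :=
  fun i => if i == k then (v i).+1 else v i.

(* [A i] counts the votes of group [i] cast by all voters other than the given
   member of group [k]. *)
Definition penalty_pivot d (T : measurableType d) (R : realType)
    (P : probability T R) (K : nat) (A : 'I_K -> {RV P >-> nat})
    (k : 'I_K) : R :=
  fine (P [set w | punished (add_vote k (fun i => A i w)) k])
  - fine (P [set w | punished (fun i => A i w) k]).

(* Main.v *)
Require Import Defs.
From mathcomp Require Import all_boot all_order all_algebra.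
From mathcomp Require Import all_classical all_reals all_analysis.
From mathcomp Require Import ring.

(** Since a vote of a member of group [k] can only lift a punishment of [k],
    [`|penalty_pivot A k|] is the probability of the pivotal event: the other
    groups all exceed [k], and the smallest of them does so by exactly one
    vote ([normr_penalty_pivot]).  Slice this event by the count [a] of group
    [k], and the pivotal event of group [j] by the count [a] of group [j]; it
    suffices to compare the two slices for every [a] ([lt_measure_slices]).

    Write [x < y] for the means of [k] and [j], [f_x], [f_y] for the masses,
    [S_x], [S_y] for the tails, and [h b] for the probability that all groups
    other than [j] and [k] have more than [b] votes.  By independence the
    slices have probabilities

      [f_x a * (S_y a * h a - S_y (a+1) * h (a+1))]  and
      [f_y a * (S_x a * h a - S_x (a+1) * h (a+1))]

    ([prob_pivotal_slice]).  Using [S a = f (a+1) + S (a+1)], the first minus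
    the second is

      [(f_x a * f_y (a+1) - f_y a * f_x (a+1)) * h a
       + (f_x a * S_y (a+1) - f_y a * S_x (a+1)) * (h a - h (a+1))]:

    the two summands separate the cases where the smallest competitor of the
    pivotal group is the other one of [j] and [k], or is a third group.  Both
    brackets are governed by the likelihood ratio [f_y n / f_x n], which is
    proportional to [(y / x) ^ n] and hence increasing in [n]: the first
    bracket is positive ([poisson_pmf_ratio_lt]) and the second, a sum of such
    terms, is nonnegative ([poisson_tail_ratio_le]).  As [h] is positive and
    nonincreasing, the difference is positive. *)
Set Implicit Arguments.
Unset Strict Implicit.
Unset Printing Implicit Defensive.

Import Order.TTheory GRing.Theory Num.Theory.

Local Open Scope ring_scope.

(** * Poisson masses and tails *)

Lemma poisson_pmf_gt0 (R : realType) (r : R) (n : nat) :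
  0 < r -> 0 < poisson_pmf r n.
Proof.
move=> r0; rewrite /poisson_pmf r0 !mulr_gt0 ?exprn_gt0 ?expR_gt0//.
Qed.

(** Monotone likelihood ratio: after cancelling the common factors this is
    [x ^ (n - a) < y ^ (n - a)]. *)
Lemma poisson_pmf_ratio_lt (R : realType) (x y : R) (a n : nat) :
  0 < x -> x < y -> (a < n)%N ->
  poisson_pmf y a * poisson_pmf x n < poisson_pmf x a * poisson_pmf y n.
Proof.
move=> x0 xy an; have y0 := lt_trans x0 xy.
have xyn : x ^+ (n - a) < y ^+ (n - a).
  by rewrite ltrXn2r ?subn_eq0 -?ltnNge ?nnegrE ?ltW.
have powE (z : R) : z ^+ n = z ^+ a * z ^+ (n - a).
  by rewrite -exprD (subnKC (ltnW an)).
rewrite /poisson_pmf x0 y0 !powE.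
pose c := x ^+ a * y ^+ a * (a`!)%:R^-1 * (n`!)%:R^-1 * expR (- x) * expR (- y).
have c0 : 0 < c.
  by rewrite !mulr_gt0 ?exprn_gt0 ?expR_gt0 ?invr_gt0 ?ltr0n ?fact_gt0.
rewrite [ltLHS](_ : _ = c * x ^+ (n - a)); last by rewrite /c; ring.
rewrite [ltRHS](_ : _ = c * y ^+ (n - a)); last by rewrite /c; ring.
by rewrite ltr_pM2l.
Qed.

Lemma poisson_prob_series (R : realType) (r : R) (U : set nat) : 0 < r ->
  poisson_prob r 0 U = (\sum_(0 <= n <oo | n \in U) (poisson_pmf r n)%:E)%E.
Proof.
move=> r0; rewrite /poisson_prob r0 nneseries_esum ?set_mem_set// => n _.
by rewrite lee_fin poisson_pmf_ge0.
Qed.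

Lemma poisson_prob_fin_num (R : realType) (r : R) (U : set nat) :
  poisson_prob r 0 U \is a fin_num.
Proof. exact: fin_num_measure. Qed.

Definition poisson_tail (R : realType) (r : R) (b : nat) : R :=
  fine (poisson_prob r 0 [set n | (b < n)%N]%classic).

(** Sum of the likelihood ratio inequalities over all counts above [b]. *)
Lemma poisson_tail_ratio_le (R : realType) (x y : R) (a b : nat) :
  0 < x -> x < y -> (a <= b)%N ->
  poisson_pmf y a * poisson_tail x b <= poisson_pmf x a * poisson_tail y b.
Proof.
move=> x0 xy ab; have y0 := lt_trans x0 xy.
rewrite -lee_fin !EFinM !fineK ?poisson_prob_fin_num// !poisson_prob_series//.
rewrite -!nneseriesZl; try by move=> n _; rewrite lee_fin poisson_pmf_ge0.
apply: lee_nneseries => n.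
  by rewrite -EFinM lee_fin mulr_ge0 ?poisson_pmf_ge0.
rewrite inE /= => bn; rewrite -!EFinM lee_fin ltW//.
exact: poisson_pmf_ratio_lt (leq_ltn_trans ab bn).
Qed.

Lemma poisson_prob1 (R : realType) (r : R) (n : nat) : 0 < r ->
  poisson_prob r 0 [set n]%classic = (poisson_pmf r n)%:E.
Proof.
by move=> r0; rewrite /poisson_prob r0 esum_set1// lee_fin poisson_pmf_ge0.
Qed.

Lemma poisson_tailS (R : realType) (r : R) (b : nat) : 0 < r ->
  poisson_tail r b = poisson_pmf r b.+1 + poisson_tail r b.+1.
Proof.
move=> r0; rewrite /poisson_tail.
rewrite (_ : [set n | _]%classic = [set b.+1] `|` [set n | (b.+1 < n)%N])%classic.
  rewrite measureU//; last first.
    by apply/seteqP; split=> n //= -[-> ]; rewrite ltnn.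
  rewrite fineD ?poisson_prob_fin_num//; congr (_ + _).
  by rewrite [X in fine X]poisson_prob1.
apply/seteqP; split=> n /=; last by case=> [->|/ltnW].
by rewrite leq_eqVlt => /orP[/eqP ->|]; [left|right].
Qed.

Lemma poisson_tail_gt0 (R : realType) (r : R) (b : nat) :
  0 < r -> 0 < poisson_tail r b.
Proof.
move=> r0; rewrite poisson_tailS// ltr_pwDl ?poisson_pmf_gt0//.
exact/fine_ge0/measure_ge0.
Qed.

Lemma poisson_tail_le (R : realType) (r : R) (b : nat) :
  0 < r -> poisson_tail r b.+1 <= poisson_tail r b.
Proof. by move=> r0; rewrite [leRHS]poisson_tailS// lerDr poisson_pmf_ge0. Qed.

(** The heart of the comparison.  Both sides are probabilities of a slice of a
    pivotal event; splitting the tails at [a.+1] exhibits their difference as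
    a positive multiple of [h] plus a nonnegative multiple of [h - h']. *)
Lemma pivotal_mass_lt (R : realType) (x y h h' : R) (a : nat) :
  0 < x -> x < y -> 0 < h -> h' <= h ->
  poisson_pmf y a * (poisson_tail x a * h - poisson_tail x a.+1 * h')
  < poisson_pmf x a * (poisson_tail y a * h - poisson_tail y a.+1 * h').
Proof.
move=> x0 xy h0 h'h; have y0 := lt_trans x0 xy.
rewrite (poisson_tailS a x0) (poisson_tailS a y0).
have := poisson_tail_ratio_le x0 xy (leqnSn a); rewrite -subr_ge0 => le.
have := poisson_pmf_ratio_lt x0 xy (ltnSn a); rewrite -subr_gt0 => lt.
rewrite -subr_gt0.
have h1 : 0 <= h - h' by rewrite subr_ge0.
have := ltr_pwDl (mulr_gt0 lt h0) (mulr_ge0 le h1).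
congr (0 < _); ring.
Qed.

Local Open Scope classical_set_scope.

(** * Comparing probabilities slice by slice *)

Lemma measure_slices d (T : measurableType d) (R : realType)
    (P : probability T R) (X : {RV P >-> nat}) (E : set T) : measurable E ->
  P E = (\sum_(0 <= a <oo) P (E `&` X @^-1` [set a]))%E.
Proof.
move=> mE; have mS a : measurable (E `&` X @^-1` [set a]).
  exact: measurableI mE (measurable_funPTI X I).
rewrite -measure_semi_bigcup//.
- congr (P _); apply/seteqP; split=> [w Ew|w [a _ []//]].
  by exists (X w).
- exact: trivIset_preimage1_in.
- exact: bigcup_measurable.
Qed.

(** The sums over all slices are finite, so that termwise strict inequality of
    the series, in fact already at the first term, is inherited by the sums. *)
Lemma lt_measure_slices d (T : measurableType d) (R : realType)
    (P : probability T R) (X Y : {RV P >-> nat}) (E F : set T) :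
  measurable E -> measurable F ->
  (forall a, P (E `&` X @^-1` [set a]) < P (F `&` Y @^-1` [set a]))%E ->
  (P E < P F)%E.
Proof.
move=> mE mF EF; have PE : P E \is a fin_num by exact: fin_num_measure.
move: PE; rewrite (measure_slices X mE) (measure_slices Y mF).
rewrite !(@nneseries_recl R xpredT) //.
rewrite fin_numD => /andP[_ fin]; apply: lte_leD => //.
by apply: lee_nneseries => // n _; exact/ltW.
Qed.

(** * Pivotal events *)

Definition pivotal d (T : measurableType d) (R : realType)
    (P : probability T R) (K : nat) (A : 'I_K -> {RV P >-> nat}) (k : 'I_K) :
    set T :=
  [set w | punished (A ^~ w) k] `\`
  [set w | punished (add_vote k (A ^~ w)) k].

(** Once the count [a] of group [k] is fixed, both punishment events become
    products of constraints on the single groups: [b = a] is the case of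
    abstention, [b = a.+1] that of an additional vote. *)
Definition cell d (T : measurableType d) (R : realType)
    (P : probability T R) (K : nat) (A : 'I_K -> {RV P >-> nat}) (k : 'I_K)
    (a b : nat) : set T :=
  [set w | A k w = a /\ forall i, i != k -> (b < A i w)%N].

(** * Measurability and slices of the pivotal events *)

Section counts.
Context d (T : measurableType d) (R : realType) (P : probability T R)
  (K : nat) (A : 'I_K -> {RV P >-> nat}).
Implicit Types (k : 'I_K) (a b : nat).

Lemma punished_slice k a :
  [set w | punished (A ^~ w) k] `&` A k @^-1` [set a] = cell A k a a.
Proof.
apply/seteqP; split=> w /= [] H Hk; split=> //; first by rewrite -Hk.
by move=> i ik; rewrite H; exact: Hk.
Qed.

Lemma punished_add_vote_slice k a :
  [set w | punished (add_vote k (A ^~ w)) k] `&` A k @^-1` [set a]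
  = cell A k a a.+1.
Proof.
apply/seteqP; split=> w /= [] H Hk; split=> //.
  by move=> i ik; move: (H i ik); rewrite /add_vote eqxx (negPf ik) Hk.
by move=> i ik; rewrite /add_vote eqxx (negPf ik) H; exact: Hk.
Qed.

(** The form to which mutual independence applies. *)
Lemma cell_bigcap k a b : cell A k a b =
  \bigcap_i A i @^-1` (if i == k then [set a] else [set n | (b < n)%N]).
Proof.
apply/seteqP; split=> w /=.
  move=> [wk wi] i _ /=; case: ifPn => [/eqP -> //|]; exact: wi.
move=> H; split; first by have := H k I; rewrite /= eqxx.
by move=> i ik; have := H i I; rewrite /= (negPf ik).
Qed.

Lemma measurable_cell k a b : measurable (cell A k a b).
Proof.
rewrite cell_bigcap; apply: fin_bigcap_measurable => [|i _].
  exact: finite_finset.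
exact: (measurable_funPTI (A i)).
Qed.

Lemma measurable_slices k (E : set T) :
  (forall a, measurable (E `&` A k @^-1` [set a])) -> measurable E.
Proof.
move=> mE; rewrite (_ : E = \bigcup_a (E `&` A k @^-1` [set a])).
  exact: bigcup_measurable.
by apply/seteqP; split=> [w Ew|w [a _ []//]]; exists (A k w).
Qed.

Lemma measurable_punished k : measurable [set w | punished (A ^~ w) k].
Proof.
apply: (@measurable_slices k) => a; rewrite punished_slice.
exact: measurable_cell.
Qed.

Lemma measurable_punished_add_vote k :
  measurable [set w | punished (add_vote k (A ^~ w)) k].
Proof.
apply: (@measurable_slices k) => a; rewrite punished_add_vote_slice.
exact: measurable_cell.
Qed.

Lemma measurable_pivotal k : measurable (pivotal A k).
Proof.
apply: measurableD; first exact: measurable_punished.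
exact: measurable_punished_add_vote.
Qed.

(** Punishment in spite of an additional vote implies punishment without it,
    so that the pivot is minus the probability of a set difference. *)
Lemma normr_penalty_pivot k : `|penalty_pivot A k| = fine (P (pivotal A k)).
Proof.
have m1 := measurable_punished k; have m2 := measurable_punished_add_vote k.
have fin E : measurable E -> P E \is a fin_num by exact: fin_num_measure.
rewrite measureD ?ltey_eq ?fin// setIidr; last first.
  move=> w /= pw i ik; have := pw i ik.
  by rewrite /add_vote eqxx (negPf ik) => /ltnW.
rewrite fineB ?fin// /penalty_pivot distrC ger0_norm// subr_ge0.
apply: fine_le; rewrite ?fin//; apply: le_measure; rewrite ?inE//.
move=> w /= pw i ik; have := pw i ik.
by rewrite /add_vote eqxx (negPf ik) => /ltnW.
Qed.

Lemma pivotal_slice k a :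
  pivotal A k `&` A k @^-1` [set a] = cell A k a a `\` cell A k a a.+1.
Proof.
rewrite -punished_slice -punished_add_vote_slice /pivotal.
apply/seteqP; split=> w /=.
  by move=> [[p1 p2] wa]; split=> // -[].
by move=> [[p1 wa] p2]; split=> //; split=> // p3; apply: p2.
Qed.

End counts.

(** * Probabilities of the slices *)

Lemma prob_cell d (T : measurableType d) (R : realType)
    (P : probability T R) (K : nat) (A : 'I_K -> {RV P >-> nat})
    (lambda : 'I_K -> R) (k : 'I_K) (a b : nat) :
  (forall i, has_poisson_law (A i) (lambda i)) -> mutually_independent A ->
  (forall i, 0 < lambda i) ->
  P (cell A k a b) = (poisson_pmf (lambda k) a *
                      \prod_(i | i != k) poisson_tail (lambda i) b)%:E.
Proof.
move=> hA indA l0; rewrite cell_bigcap.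
have -> : [set: 'I_K] = [set` finset.setTfor 'I_K].
  by apply/seteqP; split=> i //= _; rewrite finset.in_setT.
rewrite indA => [|i _]; last exact: I.
rewrite (bigD1 k) ?finset.in_setT//= eqxx EFinM -prodEFin; congr (_ * _)%E.
  by rewrite -[LHS]/(distribution P (A k) [set a]) hA poisson_prob1.
apply: eq_big => [i|i /andP[_ /negPf ->]]; first by rewrite finset.in_setT.
rewrite -[LHS]/(distribution P (A i) [set n | (b < n)%N]) hA.
by rewrite fineK ?poisson_prob_fin_num.
Qed.

(** Singling out one competitor [j] leaves a product [h] which is the same
    when the roles of [j] and [k] are exchanged. *)
Lemma prob_pivotal_slice d (T : measurableType d) (R : realType)
    (P : probability T R) (K : nat) (A : 'I_K -> {RV P >-> nat})
    (lambda : 'I_K -> R) (k j : 'I_K) (a : nat) :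
  (forall i, has_poisson_law (A i) (lambda i)) -> mutually_independent A ->
  (forall i, 0 < lambda i) -> j != k ->
  let h b := \prod_(i | (i != k) && (i != j)) poisson_tail (lambda i) b in
  P (pivotal A k `&` A k @^-1` [set a])
  = (poisson_pmf (lambda k) a *
      (poisson_tail (lambda j) a * h a
       - poisson_tail (lambda j) a.+1 * h a.+1))%:E.
Proof.
move=> hA indA l0 jk h; rewrite pivotal_slice.
have mC b : measurable (cell A k a b) by exact: measurable_cell.
have -> : P (cell A k a a `\` cell A k a a.+1)
    = (P (cell A k a a) - P (cell A k a a.+1))%E.
  rewrite measureD ?ltey_eq ?fin_num_measure//; congr (_ - P _)%E.
  by apply: setIidr => w /= [wk wi]; split=> // i /wi/ltnW.
rewrite !(prob_cell _ _ _ hA indA l0) -EFinB -mulrBr.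
by rewrite !(bigD1 j jk).
Qed.

Theorem proposition4 (R : realType) (d : measure_display)
    (T : measurableType d) (P : probability T R)
    (K : nat) (hK : (2 <= K)%N)
    (lambda : 'I_K -> R) (A : 'I_K -> {RV P >-> nat})
    (hA : forall i, has_poisson_law (A i) (lambda i))
    (indA : mutually_independent A)
    (lambda_gt0 : forall i, 0 < lambda i)
    (j k : 'I_K) (hjk : lambda j > lambda k) :
  `|penalty_pivot A k| > `|penalty_pivot A j|.
Proof.
have jk : j != k by apply: contraTneq hjk => ->; rewrite ltxx.
rewrite !normr_penalty_pivot.
have [mj mk] := (measurable_pivotal A j, measurable_pivotal A k).
apply: fine_lt; rewrite ?fin_num_measure//.
apply: (lt_measure_slices (X := A j) (Y := A k) mj mk) => a.
rewrite (prob_pivotal_slice _ hA indA lambda_gt0 jk).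
rewrite (prob_pivotal_slice _ hA indA lambda_gt0 (k := j) (j := k)) 1?eq_sym//.
rewrite lte_fin.
under [X in _ * (_ * X - _)]eq_bigl do rewrite andbC.
under [X in _ * (_ - _ * X)]eq_bigl do rewrite andbC.
apply: pivotal_mass_lt => //.
  by apply: prodr_gt0 => i _; exact: poisson_tail_gt0.
apply: ler_prod => i _; rewrite ltW ?poisson_tail_gt0//=.
exact: poisson_tail_le.
Qed.
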